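(* Let $[\widehat{0},\widehat{1}]$ be an Eulerian poset of rank $\rho(\widehat{1})\geq 1$. Its short toric polynomial satisfies the recurrence $$ \operatorname{t}([\widehat{0},\widehat{1}),x)=U_{\geq 0}\left((x^{-1}-x)^{\rho(\widehat{1})-1} +\sum_{\widehat{0}<p<\widehat{1}} U_{\geq 1}\left(\operatorname{t}([\widehat{0},p),x)\, (x-x^{-1})\right)(x^{-1}-x)^{\rho(\widehat{1})-\rho(p)-1}\right). $$
   Context: A graded poset is a finite poset with a unique minimum $\widehat{0}$, a unique maximum $\widehat{1}$ and a rank function $\rho:P\to\mathbb{N}$ with $\rho(\widehat{0})=0$ and $\rho(y)=\rho(x)+1$ whenever $y$ covers $x$; its rank is $\rho(\widehat{1})$. It is Eulerian if $\sum_{z\in[u,v]}(-1)^{\rho(z)}=0$ for all $u<v$. Write $[\widehat{0},p)=\{q: q<p\}$; the intervals $[\widehat{0},p]$ of an Eulerian poset are Eulerian. Stanley's toric polynomials: $f(\emptyset,x)=g(\emptyset,x)=1$ ($\emptyset$ being $[\widehat{0},\widehat{1})$ for the Eulerian poset of rank $0$), and for an Eulerian poset $[\widehat{0},\widehat{1}]$ of rank at least $1$, $$f([\widehat{0},\widehat{1}),x)=\sum_{p\in[\widehat{0},\widehat{1})} g([\widehat{0},p),x)(x-1)^{\rho(\widehat{1})-1-\rho(p)},$$ $$g([\widehat{0},\widehat{1}),x)=\sum_{i=0}^{\lfloor(\rho(\widehat{1})-1)/2\rfloor}\left([x^i]f([\widehat{0},\widehat{1}),x)-[x^{i-1}]f([\widehat{0},\widehat{1}),x)\right)x^i,$$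 where $[x^i]$ denotes the coefficient of $x^i$. By a theorem of Stanley, if the rank is $n+1$ then $f([\widehat{0},\widehat{1}),x)$ has degree $n$ and satisfies $x^nf([\widehat{0},\widehat{1}),1/x)=f([\widehat{0},\widehat{1}),x)$. Short toric polynomial: for an Eulerian poset of rank $n+1$, $\operatorname{t}([\widehat{0},\widehat{1}),x)$ is the unique polynomial $q(x)$ of degree $n$ with $q(x)=(-1)^nq(-x)$ and $f([\widehat{0},\widehat{1}),x)=x^{n/2}\left(q(\sqrt{x})+q(1/\sqrt{x})-q(0)\right)$; equivalently, $q(x)$ is obtained from $x^{n}f([\widehat{0},\widehat{1}),x^{-2})$ by discarding all terms of negative degree. Also $\operatorname{t}(\emptyset,x)=1$. For $z\in\mathbb{Z}$, $U_{\geq z}$ is the linear operator on Laurent polynomials in $x$ that discards all terms of degree less than $z$. *)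

(* Defs.v *)
From HB Require Import structures.
From mathcomp Require Import all_boot all_order all_algebra.
From mathcomp Require Import boolp classical_sets.
From mathcomp Require Import finmap monalg zify.

Set Implicit Arguments.
Unset Strict Implicit.
Unset Printing Implicit Defensive.

Import Order.TTheory GRing.Theory Num.Theory.

Local Open Scope fset_scope.
Local Open Scope ring_scope.

(** * Laurent polynomials with integer coefficients *)

(* Finitely supported functions from exponents to coefficients: [u@_k] is the
   coefficient of x^k in [u]. The product of [monalg] is not available here,
   as it requires a monoid of exponents without nontrivial units. *)
Definition laurent : Type := {malg int[int]}.

HB.instance Definition _ := GRing.Zmodule.on laurent.

(* the monomial x^k *)
Definition lX (k : int) : laurent := << 1 *g k >>.

Definition lmul (u v : laurent) : laurent :=
  \sum_(i <- msupp u) \sum_(j <- msupp v) << u@_i * v@_j *g i + j >>.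

Section LaurentRing.
Implicit Types u v w : laurent.

Lemma lmulw (d1 d2 : {fset int}) u v :
    msupp u `<=` d1 -> msupp v `<=` d2 ->
  lmul u v = \sum_(i <- d1) \sum_(j <- d2) << u@_i * v@_j *g i + j >>.
Proof.
move=> le1 le2; rewrite /lmul (big_fset_incl _ le1) /=.
  apply: eq_bigr => i _; apply: big_fset_incl => // j _ /mcoeff_outdom ->.
  by rewrite mulr0 monalgU0.
by move=> i _ /mcoeff_outdom ui; rewrite big1 // => j _; rewrite ui mul0r monalgU0.
Qed.

Lemma lmulC : commutative lmul.
Proof.
move=> u v; rewrite /lmul exchange_big; apply: eq_bigr => j _.
by apply: eq_bigr => i _; rewrite mulrC addrC.
Qed.

Lemma lmulDl : left_distributive lmul +%R.
Proof.
move=> u v w; rewrite (lmulw (msuppD_le u v) (fsubset_refl _)).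
rewrite (lmulw (fsubsetUl _ (msupp v)) (fsubset_refl (msupp w))).
rewrite (lmulw (fsubsetUr (msupp u) _) (fsubset_refl (msupp w))).
rewrite -big_split; apply: eq_bigr => i _; rewrite -big_split.
by apply: eq_bigr => j _; rewrite mcoeffD mulrDl monalgUD.
Qed.

Lemma lmulDr : right_distributive lmul +%R.
Proof. by move=> u v w; rewrite lmulC lmulDl !(lmulC _ u). Qed.

Lemma lmul0 u : lmul 0 u = 0.
Proof. by rewrite /lmul msupp0 big_seq_fset0. Qed.

Lemma lmulr0 u : lmul u 0 = 0.
Proof. by rewrite lmulC lmul0. Qed.

Lemma lmulUU (a b i j : int) :
  lmul << a *g i >> << b *g j >> = << a * b *g i + j >>.
Proof. by rewrite (lmulw msuppU_le msuppU_le) !big_seq_fset1 !mcoeffUU. Qed.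

Lemma lmul_suml I (r : seq I) (F : I -> laurent) v :
  lmul (\sum_(i <- r) F i) v = \sum_(i <- r) lmul (F i) v.
Proof.
exact: (big_morph (lmul^~ v) (fun _ _ => lmulDl _ _ _) (lmul0 _)).
Qed.

Lemma lmul_sumr I (r : seq I) (F : I -> laurent) v :
  lmul v (\sum_(i <- r) F i) = \sum_(i <- r) lmul v (F i).
Proof.
exact: (big_morph (lmul v) (fun _ _ => lmulDr _ _ _) (lmulr0 _)).
Qed.

Lemma lmulA : associative lmul.
Proof.
move=> u v w.
have mono u1 : u1 = \sum_(k <- msupp u1) << u1@_k *g k >> := monalgE u1.
have A1 i j (a b : int) : lmul << a *g i >> (lmul << b *g j >> w) =
    lmul (lmul << a *g i >> << b *g j >>) w.
  rewrite (mono w) 3!(lmul_sumr (msupp w)); apply: eq_bigr => k _.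
  by rewrite !lmulUU mulrA addrA.
have A2 i (a : int) : lmul << a *g i >> (lmul v w) =
    lmul (lmul << a *g i >> v) w.
  rewrite (mono v) (lmul_suml (msupp v)) 2!(lmul_sumr (msupp v)).
  rewrite (lmul_suml (msupp v)).
  by apply: eq_bigr => j _; apply: A1.
by rewrite (mono u) 3!(lmul_suml (msupp u)); apply: eq_bigr => i _; apply: A2.
Qed.

Lemma lmul1 : left_id (lX 0) lmul.
Proof.
move=> u; rewrite [u in lmul _ u]monalgE lmul_sumr [RHS]monalgE.
by apply: eq_bigr => k _; rewrite /lX lmulUU mul1r add0r.
Qed.

Lemma lX0_neq0 : lX 0 != 0.
Proof. by rewrite monalgU_eq0. Qed.

End LaurentRing.

HB.instance Definition _ := GRing.Zmodule_isComNzRing.Build laurent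
  lmulA lmulC lmul1 lmulDl lX0_neq0.

Lemma lXD i j : lX (i + j) = lX i * lX j.
Proof. by rewrite /GRing.mul /= lmulUU mulr1. Qed.

Lemma lX0 : lX 0 = 1. Proof. by []. Qed.

(* the polynomial [q], evaluated at the Laurent polynomial [u] *)
Definition leval (q : {poly int}) (u : laurent) : laurent :=
  (map_poly intr q).[u].

(* the operator U_{>= z} *)
Definition U_ge (z : int) (u : laurent) : laurent :=
  \sum_(k <- msupp u | z <= k) << u@_k *g k >>.

(** * Graded and Eulerian posets *)

Section Posets.
Context {d : Order.disp_t} {P : finTBPOrderType d}.
Implicit Types (rho : P -> nat) (p q : P).

Definition covers p q : bool :=
  (p < q)%O && [forall z : P, ~~ (p < z < q)%O].

Definition rank_function rho : Prop :=
  rho \bot%O = 0%N /\ forall p q, covers p q -> rho q = (rho p).+1.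

Definition eulerian rho : Prop :=
  forall p q, (p < q)%O ->
    \sum_(z : P | (p <= z <= q)%O) (-1) ^+ rho z = 0 :> int.

(** * Toric polynomials *)

(* g([0,p),x), given f = f([0,p),x) *)
Definition g_of_f rho p (f : {poly int}) : {poly int} :=
  if p == \bot%O then 1
  else \poly_(i < ((rho p).-1)./2.+1) (f`_i - (if i is j.+1 then f`_j else 0)).

(* The recursion is on a bound [k] for the number of elements of [0,p]; see
   [toric_fE] for the resulting recurrence. *)
Fixpoint toric_f_rec rho (k : nat) p : {poly int} :=
  if k is k'.+1 then
    if p == \bot%O then 1
    else \sum_(q : P | (q < p)%O)
           g_of_f rho q (toric_f_rec rho k' q)
           * ('X - 1) ^+ (rho p - 1 - rho q)
  else 0.

(* f([0,p),x) and g([0,p),x) *)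
Definition toric_f rho p : {poly int} := toric_f_rec rho #|P| p.
Definition toric_g rho p : {poly int} := g_of_f rho p (toric_f rho p).

Lemma toric_f_rec_stable rho k k' p :
    (#|[pred z : P | (z <= p)%O]| <= k)%N ->
    (#|[pred z : P | (z <= p)%O]| <= k')%N ->
  toric_f_rec rho k p = toric_f_rec rho k' p.
Proof.
have card_gt0 r : (0 < #|[pred z : P | (z <= r)%O]|)%N.
  by apply/card_gt0P; exists r; rewrite inE /=.
elim: k k' p => [|k IHk] [|k'] p;
  rewrite ?leqn0; try by move=> *; have := card_gt0 p; lia.
move=> lek lek' /=; case: ifP => // _; apply: eq_bigr => q ltqp.
have lt_card : (#|[pred z : P | (z <= q)%O]| < #|[pred z : P | (z <= p)%O]|)%N.
  apply: proper_card; apply/properP; split.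
    by apply/fintype.subsetP => z; rewrite !inE => /le_trans; apply; apply: ltW.
  by exists p; rewrite !inE // lt_geF.
by rewrite (IHk k') // -ltnS; apply: leq_trans lt_card _.
Qed.

Lemma toric_fE rho p :
  toric_f rho p =
    if p == \bot%O then 1
    else \sum_(q : P | (q < p)%O)
           toric_g rho q * ('X - 1) ^+ (rho p - 1 - rho q).
Proof.
have -> : toric_f rho p = toric_f_rec rho #|P|.+1 p.
  by apply: toric_f_rec_stable; rewrite ?leqW ?max_card.
by [].
Qed.

(* Substituting x^2 for x turns
     f(x) = x^{n/2} (q(sqrt x) + q(1 / sqrt x) - q(0))
   into an identity between Laurent polynomials. *)
Definition is_short_toric (n : nat) (f q : {poly int}) : Prop :=
  [/\ size q = n.+1,
      q = (-1) ^+ n *: (q \Po (- 'X)) &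
      leval f (lX 2) =
        lX n%:Z * (leval q (lX 1) + leval q (lX (-1)) - (q`_0)%:~R)].

(* t([0,p),x). When the poset is Eulerian, existence and uniqueness of the
   polynomial picked here follow from Stanley's theorem on the symmetry of the
   coefficients of f; the value 0 is never used. *)
Definition short_toric rho p : {poly int} :=
  if p == \bot%O then 1
  else xget 0 [set q | is_short_toric (rho p).-1 (toric_f rho p) q]%classic.

End Posets.

(* Main.v *)
Require Import Defs.
From HB Require Import structures.
From mathcomp Require Import all_boot all_order all_algebra.
From mathcomp Require Import classical_sets finmap monalg zify ring.
Set Implicit Arguments.
Unset Strict Implicit.
Unset Printing Implicit Defensive.

Import Order.TTheory GRing.Theory Num.Theory.
Local Open Scope ring_scope.

(* Stanley's duality x^(rho p) g_p(1/x) = sum_(r <= p) g_r(x) (x-1)^(rho p - rho r)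
   is proved by induction on p: substituting 1/x in the definition of f_p and
   applying the duality below p gives a double sum that the Eulerian relation
   collapses to (x-1) f_p, so f_p is palindromic, and the duality at p follows
   by comparing coefficients. Hence, with n = rho p - 1, t_p is the part of
   nonnegative degree of x^n f_p(x^-2), as well as of x^-n f_p(x^2). Expanding
   x^n f(x^-2) by the definition of f turns each summand into
   x^(rho p) g_p(x^-2) (x^-1 - x)^(n - rho p), and the differences of
   coefficients of f_p that define g_p make x^(rho p) g_p(x^-2) the part of
   positive degree of t_p (x - x^-1). *)

(* [mcoeff] with fixed structure instances: those inferred for Laurent monomials
   vary, which blocks rewriting with the lemmas on [mcoeff]. *)
Definition lcoef (u : laurent) (k : int) : int := mcoeff k u.

Section LaurentCoefficients.
Implicit Types (u v : laurent) (f q : {poly int}).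

Lemma laurentP u v : lcoef u =1 lcoef v -> u = v.
Proof. by move=> uv; apply/malgP => k; apply: uv. Qed.

Lemma lcoefD u v k : lcoef (u + v) k = lcoef u k + lcoef v k.
Proof. exact: mcoeffD. Qed.

Lemma lcoefB u v k : lcoef (u - v) k = lcoef u k - lcoef v k.
Proof. exact: mcoeffB. Qed.

Lemma lcoef_sum I (r : seq I) (A : pred I) (F : I -> laurent) k :
  lcoef (\sum_(i <- r | A i) F i) k = \sum_(i <- r | A i) lcoef (F i) k.
Proof. exact: raddf_sum (mcoeff k) _ _ _ _. Qed.

Lemma lcoef_monom (a i k : int) : lcoef << a *g i >> k = if i == k then a else 0.
Proof. by rewrite /lcoef [LHS]mcoeffU; case: eqP. Qed.

Lemma lcoef_lXM n u k : lcoef (lX n * u) k = lcoef u (k - n).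
Proof.
rewrite [u in LHS]monalgE mulr_sumr lcoef_sum [u in RHS]monalgE lcoef_sum.
apply: eq_bigr => j _.
rewrite {1}/GRing.mul /= lmulUU mul1r [LHS]lcoef_monom [RHS]lcoef_monom.
by congr (if _ then _ else _); lia.
Qed.

Lemma lX_exp k n : lX k ^+ n = lX (k *+ n).
Proof. by elim: n => [|n IHn]; rewrite ?expr0 ?mulr0n // exprS IHn mulrS lXD. Qed.

Lemma lcoef_U_ge z u k : lcoef (U_ge z u) k = if z <= k then lcoef u k else 0.
Proof.
rewrite lcoef_sum big_mkcond /= [u in RHS]monalgE lcoef_sum.
case: ifP => zk; last rewrite big1 //; last first.
  move=> j _; case: ifP => // zj; rewrite [LHS]lcoef_monom; case: eqP => // jk.
  by rewrite jk zk in zj.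
apply: eq_bigr => j _; rewrite [RHS]lcoef_monom; case: eqP => [->|jk].
  by rewrite zk [LHS]lcoef_monom eqxx.
by case: ifP => // _; rewrite [LHS]lcoef_monom; case: eqP.
Qed.

Lemma lcoef_intM (c : int) u k : lcoef (c%:~R * u) k = c * lcoef u k.
Proof.
by rewrite mulrzl /lcoef (raddfMz (mcoeff k)) -mulrzr intz mulrC.
Qed.

Lemma lcoef_lX n k : lcoef (lX n) k = (n == k)%:R.
Proof. by rewrite [LHS]lcoef_monom; case: eqP. Qed.

Lemma levalE f k : leval f (lX k) = \sum_(i < size f) (f`_i)%:~R * lX (k *+ i).
Proof. by rewrite /leval horner_poly; apply: eq_bigr => i _; rewrite lX_exp. Qed.

Lemma lcoef_leval f k i : k != 0 -> lcoef (leval f (lX k)) (k *+ i) = f`_i.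
Proof.
move=> k0; rewrite levalE lcoef_sum.
under eq_bigr => j _ do
  rewrite lcoef_intM lcoef_lX -!(mulr_natr k) (inj_eq (mulfI k0)) eqr_nat.
have [lt_i|ge_i] := ltnP i (size f).
  rewrite (bigD1 (Ordinal lt_i)) //= eqxx mulr1 big1 ?addr0 // => j.
  by rewrite -val_eqE /= => /negbTE ->; rewrite mulr0.
rewrite nth_default // big1 // => j _.
by case: eqP => [ij|]; rewrite ?mulr0 //; have := ltn_ord j; lia.
Qed.

Lemma lcoef_leval_out f k m :
  (forall i : nat, m != k *+ i) -> lcoef (leval f (lX k)) m = 0.
Proof.
move=> mk; rewrite levalE lcoef_sum big1 // => j _.
by rewrite lcoef_intM lcoef_lX eq_sym (negbTE (mk j)) mulr0.
Qed.

Lemma lcoef_levalX f m :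
  lcoef (leval f (lX 1)) m = if 0 <= m then f`_`|m| else 0.
Proof.
case: ifP => m0; first by rewrite -(@lcoef_leval f 1 `|m|) //; congr lcoef; lia.
by apply: lcoef_leval_out => i; lia.
Qed.

Lemma lcoef_levalVX f m :
  lcoef (leval f (lX (-1))) m = lcoef (leval f (lX 1)) (- m).
Proof.
rewrite lcoef_levalX; case: ifP => m0.
  by rewrite -(@lcoef_leval f (-1) `|- m|) //; congr lcoef; lia.
by apply: lcoef_leval_out => i; lia.
Qed.

Lemma lcoef_levalX2 f m : lcoef (leval f (lX 2)) m =
  if odd `|m| then 0 else lcoef (leval f (lX 1)) (m %/ 2)%Z.
Proof.
rewrite lcoef_levalX; case: ifP => om; first by apply: lcoef_leval_out => i; lia.
case: ifP => m0.
  by rewrite -(@lcoef_leval f 2 `|(m %/ 2)%Z|) //; congr lcoef; lia.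
by apply: lcoef_leval_out => i; lia.
Qed.

Lemma lcoef_levalVX2 f m :
  lcoef (leval f (lX (-2))) m = lcoef (leval f (lX 2)) (- m).
Proof.
rewrite lcoef_levalX2 lcoef_levalX; case: ifP => om.
  by apply: lcoef_leval_out => i; lia.
case: ifP => m0.
  by rewrite -(@lcoef_leval f (-2) `|(- m %/ 2)%Z|) //; congr lcoef; lia.
by apply: lcoef_leval_out => i; lia.
Qed.

Lemma lX1_sub1_mulI u v : (lX 1 - 1) * u = (lX 1 - 1) * v -> u = v.
Proof.
move=> uv; have : (lX 1 - 1) * (u - v) = 0 by apply/eqP; rewrite mulrBr uv subr_eq0.
move=> w0; apply/eqP; rewrite -subr_eq0; apply/eqP.
move: (u - v) w0 => w w0.
have shift k : lcoef w k = lcoef w (k - 1).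
  have := congr1 (lcoef^~ k) w0; rewrite mulrBl mul1r lcoefB lcoef_lXM.
  have -> : lcoef 0 k = 0 by exact: mcoeff0.
  by move/eqP; rewrite subr_eq0 eq_sym => /eqP.
have const_nat (k : nat) : lcoef w k%:Z = lcoef w 0 /\ lcoef w (- k%:Z) = lcoef w 0.
  elim: k => // k [IHk IHNk]; split.
    by rewrite shift -IHk; congr lcoef; lia.
  by rewrite -IHNk [RHS]shift; congr lcoef; lia.
have const k : lcoef w k = lcoef w 0.
  case: (intP k) => [|n|n] //; first by have [] := const_nat n.+1.
  by have [] := const_nat n.+1.
apply: laurentP => k; rewrite const [RHS]mcoeff0; apply/eqP/negPn/negP => w0n.
pose s := [seq Posz i | i <- iota 0 (size (msupp w)).+1].
have /uniq_leq_size : uniq s by rewrite map_inj_uniq ?iota_uniq // => i j [].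
move=> /(_ (msupp w)); rewrite size_map size_iota ltnn; move/(_ _)/notF; apply.
by move=> _ /mapP[i _ ->]; rewrite -mcoeff_neq0; have := const i; rewrite /lcoef => ->.
Qed.

Lemma levalM f q u : leval (f * q) u = leval f u * leval q u.
Proof. by rewrite /leval rmorphM /= hornerM. Qed.

Lemma leval_sum I (r : seq I) (A : pred I) (F : I -> {poly int}) u :
  leval (\sum_(i <- r | A i) F i) u = \sum_(i <- r | A i) leval (F i) u.
Proof. by rewrite /leval rmorph_sum /= horner_sum. Qed.

Lemma leval_subX1 n u : leval (('X - 1) ^+ n) u = (u - 1) ^+ n.
Proof. by rewrite /leval rmorphXn /= rmorphB /= map_polyX rmorph1 !hornerE. Qed.

Lemma leval1 u : leval 1 u = 1.
Proof. by rewrite /leval rmorph1 hornerC. Qed.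

End LaurentCoefficients.

Lemma coef_comp_polyNX (R : comNzRingType) (f : {poly R}) i :
  (f \Po (- 'X))`_i = (-1) ^+ i * f`_i.
Proof.
rewrite coef_comp_poly -scaleN1r.
under eq_bigr => j _ do rewrite exprZn coefZ coefXn.
have [lt_i|ge_i] := ltnP i (size f).
  rewrite (bigD1 (Ordinal lt_i)) //= eqxx mulr1 mulrC big1 ?addr0 // => j.
  by rewrite -val_eqE /= eq_sym => /negbTE ->; rewrite !mulr0.
rewrite nth_default // mulr0 big1 // => j _.
by case: eqP => [ij|_]; [rewrite ij leqNgt ltn_ord in ge_i | rewrite !mulr0].
Qed.

Lemma finporder_ind {d : Order.disp_t} {P : finPOrderType d} (S : P -> Prop) :
  (forall q, (forall p, (p < q)%O -> S p) -> S q) -> forall q, S q.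
Proof.
move=> IH q; have [n] := ubnP #|[pred z : P | (z <= q)%O]|.
elim: n q => // n IHn q leqn; apply: IH => p ltpq; apply: IHn.
rewrite -ltnS; apply: leq_trans leqn; rewrite ltnS; apply: proper_card.
apply/properP; split; last by exists q; rewrite !inE ?lexx // lt_geF.
by apply/fintype.subsetP => z; rewrite !inE => /le_trans; apply; apply: ltW.
Qed.

Section Eulerian.
Context {d : Order.disp_t} {P : finTBPOrderType d} (rho : P -> nat).
Hypotheses (rho_rank : rank_function rho) (P_eulerian : eulerian rho).
Implicit Types (p q r : P).

Lemma rho_lt p q : (p < q)%O -> (rho p < rho q)%N.
Proof.
have [n] := ubnP #|[pred z : P | (p < z < q)%O]|.
elim: n p q => // n IHn p q leqn ltpq.
have [cpq|] := boolP (covers p q); first by rewrite (rho_rank.2 _ _ cpq).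
rewrite /covers ltpq /= negb_forall => /existsP[z /negPn/andP[ltpz ltzq]].
have sub a b : (p <= a)%O -> (b <= q)%O -> ~~ (a < z < b)%O ->
    (#|[pred y : P | (a < y < b)%O]| < n)%N.
  move=> lepa lebq nz; rewrite -ltnS; apply: leq_trans leqn; rewrite ltnS.
  apply: proper_card; apply/properP; split; last first.
    by exists z; rewrite !inE // ltpz.
  apply/fintype.subsetP => y; rewrite !inE => /andP[lay lyb].
  by rewrite (le_lt_trans lepa) // (lt_le_trans lyb).
apply: (@ltn_trans (rho z)); apply: IHn => //; apply: sub; rewrite ?lexx ?ltxx ?andbF //.
  exact: ltW.
exact: ltW.
Qed.

Lemma rho_gt0 p : p != \bot%O -> (0 < rho p)%N.
Proof. by rewrite -lt0x -rho_rank.1; apply: rho_lt. Qed.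

Lemma eulerian_lt r q : (r < q)%O ->
  \sum_(p : P | (r <= p < q)%O) (-1) ^+ (rho q - rho p) = -1 :> int.
Proof.
move=> ltrq; have := P_eulerian ltrq.
rewrite (bigD1 q) ?lexx ?ltW //= => /eqP; rewrite addr_eq0 => /eqP Eq.
under eq_bigr => p /andP[_ /rho_lt/ltnW le] do
  rewrite -signr_odd oddB // signr_addb !signr_odd.
rewrite -mulr_sumr.
have -> : \sum_(p : P | (r <= p < q)%O) (-1) ^+ rho p = - (-1) ^+ rho q :> int.
  rewrite Eq opprK; apply: eq_bigl => p; rewrite lt_neqAle.
  by case: (r <= p)%O; rewrite //= andbC.
by rewrite mulrN -expr2 sqrr_sign.
Qed.

Lemma toric_g_bot : toric_g rho \bot%O = 1.
Proof. by rewrite /toric_g /g_of_f eqxx. Qed.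

Lemma coef_toric_g p i : p != \bot%O -> (toric_g rho p)`_i =
  if (i <= (rho p).-1./2)%N
  then (toric_f rho p)`_i - (if i is j.+1 then (toric_f rho p)`_j else 0) else 0.
Proof. by move=> /negbTE p0; rewrite /toric_g /g_of_f p0 coef_poly ltnS. Qed.

Lemma lcoef_toric_g p k : p != \bot%O ->
  lcoef (leval (toric_g rho p) (lX 1)) k =
  if k *+ 2 <= (rho p).-1%:Z
  then lcoef (leval (toric_f rho p) (lX 1)) k - lcoef (leval (toric_f rho p) (lX 1)) (k - 1)
  else 0.
Proof.
move=> p0; rewrite !lcoef_levalX; case: (intP k) => [|i|i].
- by rewrite coef_toric_g // mul0rn.
- rewrite coef_toric_g //= ?subn1. congr (if _ then _ else _); lia.
- have neg : (0 <= - i.+1%:Z) = false by lia.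
  have neg1 : (0 <= - i.+1%:Z - 1) = false by lia.
  rewrite neg neg1; by case: (_ <= _).
Qed.

Lemma toric_f_coef0 p : (toric_f rho p)`_0 = 1.
Proof.
elim/(@finporder_ind _ P): p => q IH; rewrite toric_fE; case: ifP => [_|/negbT q0].
  by rewrite coefC.
have lt0q : (\bot < q)%O by rewrite lt0x.
rewrite coef_sum.
have -> : \sum_(p | (p < q)%O) (toric_g rho p * ('X - 1) ^+ (rho q - 1 - rho p))`_0
   = \sum_(p | (\bot <= p < q)%O) - (-1) ^+ (rho q - rho p) :> int.
  apply: eq_big => p; first by rewrite le0x.
  move=> ltpq; rewrite -!horner_coef0 hornerM horner_exp !hornerE horner_coef0.
  have -> : (toric_g rho p)`_0 = 1.
    have [->|p0] := eqVneq p \bot%O; first by rewrite toric_g_bot coefC.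
    by rewrite coef_toric_g // subr0 IH.
  rewrite mul1r.
  have -> : (rho q - rho p = (rho q - 1 - rho p).+1)%N by have := rho_lt ltpq; lia.
  by rewrite exprS mulN1r opprK.
by rewrite sumrN eulerian_lt ?opprK.
Qed.

Definition kls_dual p : Prop :=
  lX (rho p) * leval (toric_g rho p) (lX (-1)) =
    \sum_(r | (r <= p)%O) leval (toric_g rho r) (lX 1) * (lX 1 - 1) ^+ (rho p - rho r).

Lemma toric_f_dual q : q != \bot%O -> (forall p, (p < q)%O -> kls_dual p) ->
  forall k, lcoef (leval (toric_f rho q) (lX 1)) k =
    lcoef (leval (toric_f rho q) (lX 1)) ((rho q).-1%:Z - k).
Proof.
move=> q0 IH; suff dual :
    lX (rho q).-1%:Z * leval (toric_f rho q) (lX (-1)) = leval (toric_f rho q) (lX 1).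
  by move=> k; rewrite -[in LHS]dual lcoef_lXM lcoef_levalVX opprB.
apply: lX1_sub1_mulI.
rewrite toric_fE (negbTE q0) mulrA !leval_sum [LHS]mulr_sumr [RHS]mulr_sumr.
have lX1V : lX 1 * lX (-1) = 1 by rewrite -lXD.
transitivity (\sum_(p | (p < q)%O) \sum_(r | (r <= p)%O)
    - ((-1) ^+ (rho q - rho p))%:~R *
    (leval (toric_g rho r) (lX 1) * (lX 1 - 1) ^+ (rho q - rho r))).
  apply: eq_bigr => p ltpq; have lt_rho := rho_lt ltpq.
  rewrite levalM leval_subX1.
  set m := (rho q - 1 - rho p)%N.
  have -> : (rho q).-1%:Z = (rho p)%:Z + m%:Z by lia.
  rewrite lXD.
  have -> : lX m = lX 1 ^+ m by rewrite lX_exp natz.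
  rewrite -!mulrA; transitivity ((lX 1 - 1) * (lX 1 * (lX (-1) - 1)) ^+ m *
    (lX (rho p) * leval (toric_g rho p) (lX (-1)))).
    by rewrite exprMn; ring.
  rewrite (IH p ltpq) mulr_sumr; apply: eq_bigr => r lerp.
  have lrp : (rho r <= rho p)%N.
    by move: lerp; rewrite le_eqVlt => /predU1P[->//|/rho_lt/ltnW].
  have -> : lX 1 * (lX (-1) - 1) = - (lX 1 - 1) by rewrite mulrBr lX1V mulr1 opprB.
  have -> : (rho q - rho p = m.+1)%N by rewrite /m; lia.
  have -> : (rho q - rho r = m.+1 + (rho p - rho r))%N by rewrite /m; lia.
  rewrite [(- (_ - _)) ^+ m]exprNn rmorphXn /= rmorphN1 exprD !exprS; ring.
rewrite (exchange_big_dep (fun r => (r < q)%O)) /=; last first.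
  by move=> p r ltpq lerp; apply: le_lt_trans ltpq.
apply: eq_bigr => r ltrq; rewrite -mulr_suml sumrN -rmorph_sum /=.
under eq_bigl => p do rewrite andbC.
rewrite eulerian_lt // levalM leval_subX1.
have -> : (rho q - rho r = (rho q - 1 - rho r).+1)%N by have := rho_lt ltrq; lia.
rewrite exprS rmorphN1; ring.
Qed.

Lemma kls_dualP p : kls_dual p.
Proof.
elim/(@finporder_ind _ P): p => q IH; rewrite /kls_dual (bigD1 q) //= subnn expr0 mulr1.
under eq_bigl => r do rewrite andbC -lt_neqAle.
have [->|q0] := eqVneq q \bot%O.
  by rewrite big_pred0 ?toric_g_bot ?leval1 ?rho_rank.1 ?addr0 ?mulr1 // => r; rewrite ltx0.
have rq : (0 < rho q)%N by apply: rho_gt0.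
have -> : \sum_(r | (r < q)%O) leval (toric_g rho r) (lX 1) * (lX 1 - 1) ^+ (rho q - rho r) =
    lX 1 * leval (toric_f rho q) (lX 1) - leval (toric_f rho q) (lX 1).
  rewrite toric_fE (negbTE q0) leval_sum mulr_sumr -sumrB; apply: eq_bigr => r ltrq.
  rewrite levalM leval_subX1.
  have -> : (rho q - rho r = (rho q - 1 - rho r).+1)%N by have := rho_lt ltrq; lia.
  by rewrite exprS; ring.
have pal := toric_f_dual q0 IH.
apply: laurentP => k; rewrite lcoefD lcoefB !lcoef_lXM lcoef_levalVX !lcoef_toric_g //.
set F := lcoef _ in pal *.
case: ifP => c1; case: ifP => c2; rewrite ?sub0r ?add0r.
- lia.
- by rewrite [X in X - _ = _]pal [X in _ - X = _]pal; congr (F _ - F _); lia.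
- by rewrite addrC addrA subrK subrr.
- rewrite [X in _ = _ - X]pal; apply/eqP; rewrite eq_sym subr_eq0; apply/eqP.
  by congr (F _); lia.
Qed.

Lemma toric_f_palindrome q m : q != \bot%O ->
  lcoef (leval (toric_f rho q) (lX 2)) m =
  lcoef (leval (toric_f rho q) (lX 2)) ((rho q).-1%:Z *+ 2 - m).
Proof.
move=> q0; rewrite !lcoef_levalX2.
have -> : odd `|(rho q).-1%:Z *+ 2 - m|%N = odd `|m| by lia.
case: ifP => om //; rewrite (toric_f_dual q0) => [|p _]; last exact: kls_dualP.
by congr lcoef; lia.
Qed.

Lemma short_toric_exists q : q != \bot%O ->
  exists t, is_short_toric (rho q).-1 (toric_f rho q) t.
Proof.
move=> q0; set n := (rho q).-1; pose F := lcoef (leval (toric_f rho q) (lX 2)).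
have F_lt0 m : m < 0 -> F m = 0.
  move=> m0; rewrite /F lcoef_levalX2 lcoef_levalX.
  by do !(case: ifP => //); lia.
pose t := \poly_(j < n.+1) F (n%:Z - j%:Z).
have lcoef_t m : lcoef (leval t (lX 1)) m = if 0 <= m then F (n%:Z - m) else 0.
  rewrite lcoef_levalX; case: ifP => // m0; rewrite coef_poly.
  by case: ltnP => mn; [congr F | rewrite F_lt0 //]; lia.
exists t; split.
- apply: size_poly_eq; rewrite subrr /F lcoef_levalX2 lcoef_levalX /=.
  by rewrite toric_f_coef0.
- apply/polyP => i; rewrite coefZ.
  rewrite coef_comp_polyNX coef_poly; case: ltnP => // ilen; last by rewrite !mulr0.
  rewrite mulrA -exprD -signr_odd; case par: (odd _); last by rewrite expr0 mul1r.
  suff -> : F (n%:Z - i%:Z) = 0 by rewrite mulr0.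
  by rewrite /F lcoef_levalX2 ifT //; lia.
- apply: laurentP => k; rewrite lcoef_lXM lcoefB lcoefD lcoef_levalVX !lcoef_t.
  rewrite -[(t`_0)%:~R]mulr1 lcoef_intM -lX0 lcoef_lX coef_poly /= subr0 oppr_ge0.
  rewrite -/(F k) -[in LHS](subrK n%:Z k); move: (k - n%:Z) => m.
  case: (ltrgtP 0 m) => [_|_|<-]; rewrite ?mulr0 ?mulr1 ?subr0 ?addr0 ?add0r ?addrK //.
    by rewrite /F toric_f_palindrome //; congr lcoef; lia.
  by rewrite opprK addrC.
Qed.

Lemma lcoef_short_toric q k : q != \bot%O ->
  lcoef (leval (short_toric rho q) (lX 1)) k =
  if 0 <= k then lcoef (leval (toric_f rho q) (lX 2)) ((rho q).-1%:Z + k) else 0.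
Proof.
move=> q0; case: ifP => k0; last by rewrite lcoef_levalX k0.
have [t t_short] := short_toric_exists q0.
rewrite /short_toric (negbTE q0); case: xgetP => [s _|/(_ _ t_short)//].
case=> _ _ ->; rewrite lcoef_lXM lcoefB lcoefD lcoef_levalVX.
rewrite -[(s`_0)%:~R]mulr1 lcoef_intM -lX0 lcoef_lX !lcoef_levalX.
rewrite [_ + k]addrC addrK oppr_ge0; case: (ltrgtP 0 k) k0 => // [_|<-] _.
  by rewrite addr0 mulr0 subr0.
by rewrite mulr1 addrK.
Qed.

Lemma lcoef2_toric_g p k : p != \bot%O ->
  lcoef (leval (toric_g rho p) (lX 2)) k =
  if k <= (rho p).-1%:Z
  then lcoef (leval (toric_f rho p) (lX 2)) k - lcoef (leval (toric_f rho p) (lX 2)) (k - 2)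
  else 0.
Proof.
move=> p0; rewrite !lcoef_levalX2 lcoef_toric_g //.
have -> : odd `|k - 2|%N = odd `|k| by lia.
case: (boolP (odd `|k|)) => ok; first by rewrite subrr if_same.
have -> : (((k %/ 2)%Z *+ 2 <= (rho p).-1%:Z) = (k <= (rho p).-1%:Z)) by lia.
by have -> : ((k - 2) %/ 2)%Z = (k %/ 2)%Z - 1 by lia.
Qed.

Lemma lX_toric_g p : p != \bot%O ->
  lX (rho p) * leval (toric_g rho p) (lX (-2)) =
  U_ge 1 (leval (short_toric rho p) (lX 1) * (lX 1 - lX (-1))).
Proof.
move=> p0; have rp : (0 < rho p)%N by apply: rho_gt0.
apply: laurentP => k; rewrite lcoef_U_ge lcoef_lXM lcoef_levalVX2 lcoef2_toric_g //.
rewrite mulrC mulrBl lcoefB !lcoef_lXM !lcoef_short_toric //.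
have -> : (- (k - (rho p)%:Z) <= (rho p).-1%:Z) = (1 <= k) by lia.
case: (boolP (1 <= k)) => k1 //.
have -> : 0 <= k - 1 by lia.
have -> : 0 <= k - -1 by lia.
rewrite (toric_f_palindrome (- _) p0) (toric_f_palindrome (- _ - 2) p0).
by congr (lcoef _ _ - lcoef _ _); lia.
Qed.

End Eulerian.

Theorem theorem3p4 (d : Order.disp_t) (P : finTBPOrderType d) (rho : P -> nat)
    (rho_rank : rank_function rho) (P_eulerian : eulerian rho)
    (rank_ge1 : (1 <= rho \top%O)%N) :
  leval (short_toric rho \top%O) (lX 1) =
    U_ge 0 ((lX (-1) - lX 1) ^+ (rho \top%O - 1)
            + \sum_(p : P | (\bot < p < \top)%O)
                U_ge 1 (leval (short_toric rho p) (lX 1) * (lX 1 - lX (-1)))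
                * (lX (-1) - lX 1) ^+ (rho \top%O - rho p - 1)).
Proof.
have top0 : \top%O != \bot%O :> P.
  by apply/eqP => top_bot; move: rank_ge1; rewrite top_bot rho_rank.1.
pose n : int := (rho \top%O).-1.
transitivity (U_ge 0 (lX n * leval (toric_f rho \top%O) (lX (-2)))).
  apply: laurentP => k; rewrite lcoef_short_toric // lcoef_U_ge lcoef_lXM lcoef_levalVX2.
  case: ifP => // _; rewrite [LHS]toric_f_palindrome //; congr lcoef; lia.
congr U_ge; rewrite toric_fE (negbTE top0) leval_sum.
rewrite [LHS]mulr_sumr [LHS](bigD1 \bot%O); last by rewrite lt0x.
have powE m : lX m%:Z * (lX (-2) - 1) ^+ m = (lX (-1) - lX 1) ^+ m.
  have -> : lX m = lX 1 ^+ m by rewrite lX_exp natz.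
  by rewrite -exprMn mulrBr mulr1 -lXD.
congr (_ + _).
  rewrite levalM leval_subX1 toric_g_bot leval1 mul1r rho_rank.1 subn0 -powE.
  by congr (lX _ * _); rewrite /n; lia.
apply: eq_big => [p|p /andP[ltp p0]]; first by rewrite lt0x andbC.
rewrite levalM leval_subX1 -lX_toric_g // -subnDA addnC subnDA -powE.
have -> : n = (rho p)%:Z + (rho \top%O - rho p - 1)%N%:Z.
  by have := rho_lt rho_rank ltp; rewrite /n; lia.
by rewrite lXD mulrACA.
Qed.
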